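(* Let $1<p,q<\infty$ and $\alpha,\beta>0$ with $\frac{\alpha}{p}+\frac{\beta}{q}=1$, and let $a<b$. Let $\lambda_1(p,q)$ be the first Dirichlet eigenvalue on $(a,b)$ of the system $$-(|u'|^{p-2}u')'=\lambda\alpha|u|^{\alpha-2}u|v|^\beta,\qquad -(|v'|^{q-2}v')'=\lambda\beta|u|^\alpha|v|^{\beta-2}v,$$ with $u(a)=u(b)=v(a)=v(b)=0$, and for $s>1$ let $\Lambda_1(s)$ be the first Dirichlet eigenvalue of $-(|\varphi'|^{s-2}\varphi')'=\Lambda|\varphi|^{s-2}\varphi$ on $(a,b)$. Then $$\left(\alpha^{\frac{\alpha}{p}}\beta^{\frac{\beta}{q}}\right)^{-1}\left(\frac{2}{\pi_{\alpha+\beta}}\right)^{\alpha+\beta}\frac{\Lambda_1(\alpha+\beta)}{\alpha+\beta-1}\le\lambda_1(p,q).$$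
   Context: $\lambda_1(p,q)$ is the infimum over $(u,v)\in W^{1,p}_0(a,b)\times W^{1,q}_0(a,b)$ with $\int_a^b|u|^\alpha|v|^\beta>0$ of $\big(\frac1p\int_a^b|u'|^p+\frac1q\int_a^b|v'|^q\big)/\int_a^b|u|^\alpha|v|^\beta$; $\Lambda_1(s)=\inf\{\int_a^b|u'|^s/\int_a^b|u|^s: 0\ne u\in W^{1,s}_0(a,b)\}$. For $s>1$, $\pi_s=2\int_0^1\frac{dt}{(1-t^s)^{1/s}}$. *)

(* Defs.v *)
From HB Require Import structures.
From mathcomp Require Import all_boot all_order all_algebra.
From mathcomp Require Import all_classical all_reals all_analysis.
Set Implicit Arguments. Unset Strict Implicit. Unset Printing Implicit Defensive.
Import Order.TTheory GRing.Theory Num.Theory.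
Import numFieldNormedType.Exports.
Local Open Scope classical_set_scope.
Local Open Scope ring_scope.

(* W^{1,s}_0(a,b) in one dimension: u is (the continuous representative of)
   an element of W^{1,s}_0(a,b) with weak derivative g iff g is measurable on
   [a,b], g ∈ L^s(a,b), u(x) = ∫_a^x g for x ∈ [a,b] (so u(a) = 0) and u(b) = 0. *)
Definition W10 (R : realType) (a b s : R) (u g : R -> R) : Prop :=
  measurable_fun `[a, b] g /\
  (\int[@lebesgue_measure R]_(x in `[a, b]) ((`|g x| `^ s)%:E) < +oo)%E /\
  (forall x, a <= x <= b ->
     u x = Rintegral (@lebesgue_measure R) `[a, x] g) /\
  u b = 0.

Definition lambda1 (R : realType) (a b p q alpha beta : R) : R :=
  inf [set r : R | exists u g v h : R -> R,
        [/\ W10 a b p u g, W10 a b q v h,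
            0 < Rintegral (@lebesgue_measure R) `[a, b]
                  (fun x => `|u x| `^ alpha * `|v x| `^ beta) &
            r = (p^-1 * Rintegral (@lebesgue_measure R) `[a, b] (fun x => `|g x| `^ p)
                 + q^-1 * Rintegral (@lebesgue_measure R) `[a, b] (fun x => `|h x| `^ q))
                / Rintegral (@lebesgue_measure R) `[a, b]
                  (fun x => `|u x| `^ alpha * `|v x| `^ beta)]].

Definition Lambda1 (R : realType) (a b s : R) : R :=
  inf [set r : R | exists u g : R -> R,
        [/\ W10 a b s u g, exists2 x, a <= x <= b & u x != 0 &
            r = Rintegral (@lebesgue_measure R) `[a, b] (fun x => `|g x| `^ s)
                / Rintegral (@lebesgue_measure R) `[a, b] (fun x => `|u x| `^ s)]].

(* pi_s = 2 ∫_0^1 (1 - t^s)^{-1/s} dt  (a convergent improper integral; here a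
   Lebesgue integral of a nonnegative function over [0,1[) *)
Definition pi_s (R : realType) (s : R) : R :=
  2 * fine (\int[@lebesgue_measure R]_(t in `[0, 1[) (((1 - t `^ s) `^ (- s^-1))%:E)).

(* Main.v *)
(* Write s = alpha + beta and L = b - a. Both sides are compared with
   (alpha^(alpha/p) beta^(beta/q))^-1 (2/L)^s.
   The rescaled s-sine, the inverse of y |-> \int_0^y (1 - t^s)^(-1/s) dt reflected
   at the midpoint, has Rayleigh quotient (s - 1) (pi_s / L)^s, which bounds
   Lambda1(s) from above.
   Conversely u(a) = u(b) = 0 gives 2 |u| <= \int |u'| <= L^(1 - 1/p) |u'|_p, and
   similarly for v; multiplying the powers alpha and beta of these bounds,
   integrating over (a, b) and applying the weighted AM-GM inequality bounds
   lambda1(p, q) from below. *)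

Require Import Defs.
From HB Require Import structures.
From mathcomp Require Import all_boot all_order all_algebra.
From mathcomp Require Import all_classical all_reals all_analysis.
From mathcomp Require Import measurable_realfun ring lra.
Import Order.TTheory GRing.Theory Num.Theory.
Import numFieldNormedType.Exports.
Local Open Scope classical_set_scope.
Local Open Scope ring_scope.

(** * Continuity and positivity of real powers *)

Lemma continuous_powR_gt0 (R : realType) (r x : R) : 0 < x ->
  {for x, continuous (fun t : R => t `^ r)}.
Proof.
move=> x0; apply/differentiable_continuous/derivable1_diffP/derivable_powR.
by rewrite in_itv/= andbT.
Qed.

Lemma continuous_norm_powR (R : realType) (s : R) : 0 < s ->
  continuous (fun t : R => `|t| `^ s).
Proof.
move=> s0 x; have [->|x0] := eqVneq x 0.
  apply/cvgrPdist_lt => e e0; rewrite normr0 powR0 ?gt_eqF//.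
  near=> t; rewrite sub0r normrN ger0_norm ?powR_ge0//.
  have -> : e = (e `^ s^-1) `^ s by rewrite -powRrM mulVf ?gt_eqF// powRr1// ltW.
  rewrite gt0_ltr_powR ?nnegrE ?powR_ge0//.
  by near: t; exact: (@nbhs0_lt _ R^o _ (powR_gt0 s^-1 e0)).
apply: (@continuous_comp _ _ _ (fun t : R => `|t|) (fun t => t `^ s)).
  exact: norm_continuous.
by apply: continuous_powR_gt0; rewrite normr_gt0.
Unshelve. all: by end_near. Qed.

Lemma one_sub_powR_gt0 (R : realType) (s y : R) : 0 < s -> 0 <= y < 1 -> 0 < 1 - y `^ s.
Proof.
move=> s0 /andP[y0 y1]; rewrite subr_gt0 -[ltRHS](congr1 (@^~ s) (powR1 R)).
by rewrite gt0_ltr_powR ?nnegrE.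
Qed.

Lemma integrable_itv_bndo_bndc (R : realType) (a b : R) (f : R -> R) :
  (@lebesgue_measure R).-integrable `[a, b[ (EFin \o f) ->
  (@lebesgue_measure R).-integrable `[a, b] (EFin \o f).
Proof.
move=> /integrableP[/measurable_EFinP mf fi].
apply/integrableP; split.
  exact/measurable_EFinP/measurable_fun_itv_bndo_bndcP.
move: fi; rewrite integral_itv_bndo_bndc//.
by apply/measurable_EFinP; apply: measurableT_comp.
Qed.

(** * The s-sine and its inverse *)

(** The hypothesis [0 < pi_s s] encodes convergence of the improper integral: a divergent one is
    sent to 0 by [fine]. Once the integrand is integrable, [F] is its indefinite integral. *)
Lemma arcsine_s (R : realType) (s : R) : 1 < s -> 0 < pi_s s ->
  exists F : R -> R,
  [/\ F 0 = 0, F 1 = pi_s s / 2, {within `[(0 : R), 1], continuous F} &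
      forall y : R, y \in `]0, 1[ ->
        is_derive y 1 F ((1 - y `^ s) `^ (- s^-1))].
Proof.
move=> s1 pi0; have s0 : 0 < s by exact: lt_trans s1.
pose f (t : R) := (1 - t `^ s) `^ (- s^-1).
have f_cont y : y \in `]0, 1[ -> {for y, continuous f}.
  rewrite in_itv/= => /andP[y0 y1].
  apply: (@continuous_comp _ _ _ (fun t => 1 - t `^ s) (fun t => t `^ (- s^-1))).
    apply: cvgB; [exact: cvg_cst|exact: continuous_powR_gt0].
  by apply: continuous_powR_gt0; rewrite @one_sub_powR_gt0 ?(ltW y0).
have mf : measurable_fun `[(0 : R), 1[ f.
  (* Continuity is available on the open interval only; adding the endpoint 0 does not affect
     measurability. *)
  apply/measurable_fun_itv_obnd_cbndP.
  apply: open_continuous_measurable_fun; first exact: interval_open.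
  by move=> y; rewrite inE; exact: f_cont.
have intf : (@lebesgue_measure R).-integrable `[(0 : R), 1] (EFin \o f).
  apply: integrable_itv_bndo_bndc; apply/integrableP; split.
    exact/measurable_EFinP.
  under eq_integral do rewrite /= ger0_norm ?powR_ge0//.
  rewrite ltey; apply/eqP => I.
  by move: pi0; rewrite /pi_s I/= mulr0 ltxx.
exists (fun y => \int[@lebesgue_measure R]_(t in `[0, y]) f t); split.
- by rewrite set_itv1 Rintegral_set1.
- rewrite -Rintegral_itv_bndo_bndc; last first.
    apply: integrableS intf => // x; rewrite /= !in_itv/=.
    by move=> /andP[-> /ltW].
  by rewrite /pi_s [RHS]mulrAC divff// mul1r.
- exact: parameterized_integral_continuous.
- move=> y y01; have := y01; rewrite in_itv/= => /andP[y0 y1].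
  have [dF F'] := continuous_FTC1_closed y1 intf y0 (f_cont _ y01).
  by apply: DeriveDef => //; rewrite -derive1E.
Qed.

(* The inverse of [arcsine_s], extended by constants outside [0, pi_s / 2]. *)
Lemma sine_s (R : realType) (s : R) : 1 < s -> 0 < pi_s s ->
  exists w : R -> R,
  [/\ continuous w, w 0 = 0, w (pi_s s / 2) = 1, (forall t, 0 <= w t <= 1) &
      forall t : R, t \in `]0, pi_s s / 2[ ->
        0 < w t < 1 /\ is_derive t 1 w ((1 - w t `^ s) `^ s^-1)].
Proof.
move=> s1 pi0; have s0 : 0 < s by exact: lt_trans s1.
have [F [F0 F1 cF dF]] := @arcsine_s R s s1 pi0.
set P := pi_s s / 2 in F1 *; have P0 : 0 < P by rewrite divr_gt0.
(* The integrand is at least 1, so by the mean value theorem [F] does not shrink distances. This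
   gives both injectivity of [F] and a 1-Lipschitz inverse. *)
have F_expand y z : 0 <= y -> y < z -> z <= 1 -> z - y <= F z - F y.
  move=> y0 yz z1.
  have dFyz (x : R) : x \in `]y, z[ -> is_derive x 1 F ((1 - x `^ s) `^ (- s^-1)).
    rewrite in_itv/= => /andP[yx xz]; apply: dF.
    by rewrite in_itv/= (le_lt_trans y0)//= (lt_le_trans xz).
  have cFyz : {within `[y, z], continuous F}.
    apply: continuous_subspaceW cF => x; rewrite /= !in_itv/= => /andP[yx xz].
    by rewrite (le_trans y0)//= (le_trans xz).
  have [c + ->] := MVT yz dFyz cFyz.
  rewrite in_itv/= => /andP[yc cz].
  have c1 : 0 < c < 1 by rewrite (le_lt_trans y0)//= (lt_le_trans cz).
  rewrite ler_peMl ?subr_ge0 ?(ltW yz)//.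
  have c2 : 0 < 1 - c `^ s by rewrite @one_sub_powR_gt0// (ltW (andP c1).1) (andP c1).2.
  rewrite powRN invf_ge1 ?powR_gt0// -[leRHS](congr1 (@^~ s^-1) (powR1 R)).
  by rewrite ge0_ler_powR ?nnegrE ?invr_ge0 ?(ltW s0) ?(ltW c2)// gerBl powR_ge0.
(* Clamping to [[0, P]], the range of [F], makes the inverse total while keeping it continuous. *)
pose cl (t : R) := Num.min P (Num.max 0 t).
have cl_itv t : 0 <= cl t <= P 
  by rewrite /cl le_min (ltW P0) le_max lexx ge_min lexx.
have F_surj t : exists2 y, 0 <= y <= 1 & F y = cl t.
  have [|y] := @IVT R F 0 1 (cl t) ler01 cF; last by rewrite in_itv; exists y.
  by rewrite F0 F1 min_l ?max_r ?(ltW P0).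
pose w t := projT1 (cid2 (F_surj t)).
have w01 t : 0 <= w t <= 1 by rewrite /w; case: cid2.
have Fw t : F (w t) = cl t by rewrite /w; case: cid2.
have w_lip t u : `|w t - w u| <= `|cl t - cl u|.
  rewrite -!Fw; have := w01 t; have := w01 u.
  move=> /andP[u0 u1] /andP[t0 t1].
  have [tu|tu|->] := ltgtP (w t) (w u); last by rewrite !subrr.
  - have := F_expand _ _ t0 tu u1 => H; rewrite distrC (distrC (F _)).
    by rewrite ger0_norm ?subr_ge0 ?(ltW tu)// (le_trans H)// ler_norm.
  - have := F_expand _ _ u0 tu t1 => H.
    by rewrite ger0_norm ?subr_ge0 ?(ltW tu)// (le_trans H)// ler_norm.
have F_inj y z : 0 <= y <= 1 -> 0 <= z <= 1 -> F y = F z -> y = z.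
  move=> /andP[y0 y1] /andP[z0 z1] yz.
  have [tu|tu|//] := ltgtP y z.
  - by have := F_expand _ _ y0 tu z1; lra.
  - by have := F_expand _ _ z0 tu y1; lra.
have clE t : 0 <= t <= P -> cl t = t.
  by move=> /andP[t0 tP]; rewrite /cl max_r// min_r.
have wE t y : 0 <= y <= 1 -> F y = t -> 0 <= t <= P -> w t = y.
  by move=> y01 Fy t01; apply: F_inj => //; rewrite Fw clE.
exists w; split=> //.
- move=> t; apply/cvgrPdist_le => e e0.
  have cc : {for t, continuous ((cst P : R -> R^o) \min ((cst 0 : R -> R^o) \max id))}.
    apply: continuous_min; first exact: cvg_cst.
    by apply: continuous_max; [exact: cvg_cst|exact: cvg_id].
  move/cvgrPdist_le : cc => /(_ _ e0); apply: filterS => x.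
  exact/le_trans/w_lip.
- by apply: wE => //; rewrite lexx ?ler01 ?(ltW P0).
- by apply: wE => //; rewrite ?lexx ?ler01 ?(ltW P0).
move=> t; rewrite in_itv/= => /andP[t0 tP].
have Fwt : F (w t) = t by rewrite Fw clE// (ltW t0) (ltW tP).
have wt01 : 0 < w t < 1.
  have := w01 t; rewrite !le_eqVlt => /andP[/orP[/eqP e|->] /orP[/eqP e'|->]] //.
  - by move: Fwt; rewrite e' F1; lra.
  - by move: Fwt; rewrite -e F0; lra.
  - by move: Fwt; rewrite e' F1; lra.
split=> //.
have near_w : \forall y \near w t, y \in `]0, 1[.
  by apply: near_in_itvoo; rewrite in_itv.
have dp : 0 < 1 - w t `^ s.
  by rewrite @one_sub_powR_gt0// (ltW (andP wt01).1) (andP wt01).2.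
(* The slope is put in the form of the reciprocal of the derivative of [F] at [w t], as the inverse
   function rule requires. *)
rewrite -{1}Fwt -[_ `^ s^-1]invrK -powRN; apply: is_derive_inverse.
- near=> y; have : y \in `]0, 1[ by near: y.
  rewrite in_itv/= => /andP[y0 y1]; apply: wE => //; first by rewrite !ltW.
  have := F_expand _ _ (lexx _) y0 (ltW y1).
  have := F_expand _ _ (ltW y0) y1 (lexx _).
  by rewrite F0 F1; lra.
- near=> y; have : y \in `]0, 1[ by near: y.
  by move=> /dF dFy; apply/differentiable_continuous/derivable1_diffP.
- by apply: dF; rewrite in_itv.
- by rewrite gt_eqF// powR_gt0.
Unshelve. all: by end_near. Qed.

(** * Integrals along solutions of the s-sine equation *)

Lemma integrable_continuous_itv (R : realType) (a b : R) (f : R -> R) :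
  continuous f -> (@lebesgue_measure R).-integrable `[a, b] (EFin \o f).
Proof.
move=> cf; apply: continuous_compact_integrable; first exact: segment_compact.
exact: continuous_subspaceT.
Qed.

(** Differentiability is asked in the open interval only, since the s-sine is differentiated only
    there; continuity of [F] takes care of the endpoints. *)
Lemma Rintegral_FTC2 (R : realType) (f F : R -> R) (c d : R) : c < d ->
  continuous f -> continuous F -> (forall x : R, x \in `]c, d[ -> is_derive x 1 F (f x)) ->
  \int[@lebesgue_measure R]_(x in `[c, d]) f x = F d - F c.
Proof.
move=> cd cf cF dF; rewrite /Rintegral (@continuous_FTC2 _ f F)//.
- exact: continuous_subspaceT.
- split.
  + by move=> x /dF.
  + exact/cvg_at_right_filter/cF.
  + exact/cvg_at_left_filter/cF.
- by move=> x /dF xF; rewrite derive1E derive_val.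
Qed.

(* The nonlinearity of [u' = k (1 - u^s)^(1/s)], with absolute values making it
   continuous on the whole line. *)
Definition sine_slope (R : realType) (s y : R) : R := `|1 - `|y| `^ s| `^ s^-1.

Lemma continuous_sine_slope (R : realType) (s : R) : 0 < s ->
  continuous (@sine_slope R s).
Proof.
move=> s0 y.
apply: (@continuous_comp _ _ _ (fun y : R => 1 - `|y| `^ s) (fun t => `|t| `^ s^-1)).
  by apply: cvgB; [exact: cvg_cst|exact: continuous_norm_powR].
by apply: continuous_norm_powR; rewrite invr_gt0.
Qed.

(** The sign of [k] is free, so that the rising and the falling half of the reflected sine are both
    covered. *)
Lemma Rintegral_sine_slope (R : realType) (s k c d : R) (u : R -> R) :
  1 < s -> c < d -> continuous u ->
  (forall x : R, x \in `]c, d[ ->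
    0 < u x < 1 /\ is_derive x 1 u (k * (1 - u x `^ s) `^ s^-1)) ->
  \int[@lebesgue_measure R]_(x in `[c, d]) (k * sine_slope R s (u x)) = u d - u c.
Proof.
move=> s1 cd cu du; have s0 : 0 < s by exact: lt_trans s1.
apply: Rintegral_FTC2 => //.
- move=> x; apply: cvgM; first exact: cvg_cst.
  by apply: (@continuous_comp _ _ _ u); [exact: cu|exact: continuous_sine_slope].
- move=> x /du[/andP[u0 u1]]; rewrite /sine_slope (gtr0_norm u0) gtr0_norm//.
  by rewrite one_sub_powR_gt0// u1 ltW.
Qed.

(* [u (1 - u^s)^(1 - 1/s)] is a primitive of [k (1 - s u^s)]. *)
Lemma Rintegral_sine_powR (R : realType) (s k c d : R) (u : R -> R) :
  1 < s -> k != 0 -> c < d -> continuous u ->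
  (forall x : R, x \in `]c, d[ ->
    0 < u x < 1 /\ is_derive x 1 u (k * (1 - u x `^ s) `^ s^-1)) ->
  u c * (1 - `|u c| `^ s) = 0 ->
  u d * (1 - `|u d| `^ s) = 0 ->
  \int[@lebesgue_measure R]_(x in `[c, d]) (1 - s * `|u x| `^ s) = 0.
Proof.
move=> s1 k0 cd cu du uc0 ud0; have s0 : 0 < s by exact: lt_trans s1.
have e0 : 0 < 1 - s^-1 by rewrite subr_gt0 invf_lt1.
(* The absolute values make the primitive continuous on the whole line. It vanishes at the
   endpoints, where either [u] is 0 or [|u|] is 1. *)
pose H x := k^-1 * (u x * `|1 - `|u x| `^ s| `^ (1 - s^-1)).
have H0 x : u x * (1 - `|u x| `^ s) = 0 -> H x = 0.
  rewrite /H => /eqP; rewrite mulf_eq0 => /orP[|] /eqP ->.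
    by rewrite mul0r mulr0.
  by rewrite normr0 powR0 ?gt_eqF// !mulr0.
transitivity (H d - H c); last by rewrite !H0// subrr.
apply: Rintegral_FTC2 => //.
- move=> x; apply: cvgB; first exact: cvg_cst.
  apply: cvgM; first exact: cvg_cst.
  apply: (@continuous_comp _ _ _ u (fun y : R => `|y| `^ s)); first exact: cu.
  exact: continuous_norm_powR.
- move=> x; apply: cvgM; first exact: cvg_cst.
  apply: cvgM; first exact: cu.
  apply: (@continuous_comp _ _ _ u (fun y : R => `|1 - `|y| `^ s| `^ (1 - s^-1))).
    exact: cu.
  apply: (@continuous_comp _ _ _ (fun y : R => 1 - `|y| `^ s)
    (fun t => `|t| `^ (1 - s^-1))).
    by apply: cvgB; [exact: cvg_cst|exact: continuous_norm_powR].
  exact: continuous_norm_powR.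
move=> x xcd; have [/andP[u0 u1] u'] := du _ xcd.
have v0 : 0 < 1 - u x `^ s by rewrite one_sub_powR_gt0// u1 ltW.
pose H1 x := k^-1 * (u x * (1 - u x `^ s) `^ (1 - s^-1)).
have HH1 : \forall y \near x, H1 y = H y.
  near=> y; have /du[/andP[uy0 uy1] _] : y \in `]c, d[ by near: y; exact: near_in_itvoo.
  by rewrite /H1 /H (gtr0_norm uy0) gtr0_norm// one_sub_powR_gt0// uy1 ltW.
apply: (near_eq_is_derive HH1).
rewrite (gtr0_norm u0).
have D1 : is_derive x 1 (fun x => u x `^ s)
   (s * u x `^ (s - 1) * (k * (1 - u x `^ s) `^ s^-1)).
  by apply: (@is_derive1_comp _ (fun t => t `^ s) u); exact: is_derive1_powR.
have D2 : is_derive x 1 (fun x => 1 - u x `^ s)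
   (- (s * u x `^ (s - 1) * (k * (1 - u x `^ s) `^ s^-1))).
  by rewrite -sub0r; exact: is_deriveB.
have D3 : is_derive x 1 (fun x => (1 - u x `^ s) `^ (1 - s^-1))
   ((1 - s^-1) * (1 - u x `^ s) `^ (1 - s^-1 - 1)
     * (- (s * u x `^ (s - 1) * (k * (1 - u x `^ s) `^ s^-1)))).
  apply: (@is_derive1_comp _ (fun t => t `^ (1 - s^-1)) (fun x => 1 - u x `^ s)).
  exact: is_derive1_powR.
apply: is_derive_eq.
rewrite /GRing.scale/=.
set v := 1 - u x `^ s in v0 *.
(* All powers are expressed through [v^(1/s)] and [u^(s-1)], which reduces the claim to a rational
   identity. *)
have -> : v `^ (1 - s^-1) = v * (v `^ s^-1)^-1.
  by rewrite powRD ?(gt_eqF v0) ?implybT// powRr1 ?(ltW v0)// powRN.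
have -> : v `^ (1 - s^-1 - 1) = (v `^ s^-1)^-1.
  by rewrite addrAC subrr sub0r powRN.
have us : u x `^ s = u x * u x `^ (s - 1) by rewrite mulr_powRB1 ?(ltW u0).
have v'0 : v `^ s^-1 != 0 by rewrite gt_eqF// powR_gt0.
have vE : v = 1 - u x * u x `^ (s - 1) by rewrite -us.
rewrite us; move: (v `^ s^-1) v'0 => V V0; rewrite vE.
by field; rewrite V0 k0 gt_eqF.
Unshelve. all: by end_near. Qed.

Lemma Rintegral_itv_split (R : realType) (f : R -> R) (a m b : R) : a <= m <= b ->
  (@lebesgue_measure R).-integrable `[a, b] (EFin \o f) ->
  \int[@lebesgue_measure R]_(x in `[a, b]) f x =
  \int[@lebesgue_measure R]_(x in `[a, m]) f x +
  \int[@lebesgue_measure R]_(x in `[m, b]) f x.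
Proof.
move=> /andP[am mb] intf; apply/eqP; rewrite addrC -subr_eq; apply/eqP.
rewrite -[RHS]Rintegral_itv_obnd_cbnd; last first.
  apply: integrableS intf => // x; rewrite /= !in_itv/= => /andP[mx ->].
  by rewrite andbT (le_trans am) ?ltW.
by apply: Rintegral_itvB => //; rewrite bnd_simp.
Qed.

(** * The reflected s-sine as a test function *)

(** Membership for every exponent [r] lets one function serve [Lambda1] with exponent [s] and both
    components of [lambda1] with exponents [p] and [q]. *)
Lemma sine_test_function (R : realType) (s a b : R) : 1 < s -> 0 < pi_s s -> a < b ->
  exists u g : R -> R,
  [/\ forall r, 0 < r -> W10 a b r u g,
      u ((a + b) / 2) = 1,
      \int[@lebesgue_measure R]_(x in `[a, b]) (`|u x| `^ s) = (b - a) / s &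
      \int[@lebesgue_measure R]_(x in `[a, b]) (`|g x| `^ s) =
        (pi_s s / (b - a)) `^ s * ((s - 1) * ((b - a) / s))].
Proof.
move=> s1 pi0 ab; have s0 : 0 < s by exact: lt_trans s1.
have [w [cw w0 w1 w01 dw]] := sine_s R s s1 pi0.
pose k := pi_s s / (b - a); pose m := (a + b) / 2.
have ba0 : 0 < b - a by rewrite subr_gt0.
have k0 : 0 < k by rewrite divr_gt0.
have am : a < m by rewrite /m; lra.
have mb : m < b by rewrite /m; lra.
have kma : k * (m - a) = pi_s s / 2 by rewrite /k /m; field; rewrite subr_eq0 gt_eqF.
have kbm : k * (b - m) = pi_s s / 2 by rewrite /k /m; field; rewrite subr_eq0 gt_eqF.
pose u1 x := w (k * (x - a)); pose u2 x := w (k * (b - x)).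
(* [k] is scaled so that the argument runs from 0 at each end to [pi_s s / 2], where [w] is 1, at
   the midpoint. The minimum joins [u1] and [u2] into one continuous function. *)
pose u x := w (k * Num.min (x - a) (b - x)).
have u1E x : x <= m -> u x = u1 x by rewrite /u /u1 /m => xm; rewrite min_l//; lra.
have u2E x : m <= x -> u x = u2 x by rewrite /u /u2 /m => xm; rewrite min_r//; lra.
have cu1 : continuous u1.
  move=> x; apply: (@continuous_comp _ _ _ (fun x => k * (x - a)) w); last exact: cw.
  by apply: cvgM; [exact: cvg_cst|apply: cvgB; [exact: cvg_id|exact: cvg_cst]].
have cu2 : continuous u2.
  move=> x; apply: (@continuous_comp _ _ _ (fun x => k * (b - x)) w); last exact: cw.
  by apply: cvgM; [exact: cvg_cst|apply: cvgB; [exact: cvg_cst|exact: cvg_id]].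
have cu : continuous u.
  move=> x; apply: (@continuous_comp _ _ _ (fun x => k * Num.min (x - a) (b - x)) w);
    last exact: cw.
  apply: cvgM; first exact: cvg_cst.
  have : {for x, continuous ((fun x => x - a : R^o) \min (fun x => b - x : R^o))}.
    apply: continuous_min.
      by apply: cvgB; [exact: cvg_id|exact: cvg_cst].
    by apply: cvgB; [exact: cvg_cst|exact: cvg_id].
  by [].
have du1 (x : R) : x \in `]a, m[ ->
    0 < u1 x < 1 /\ is_derive x 1 u1 (k * (1 - u1 x `^ s) `^ s^-1).
  rewrite in_itv/= => /andP[ax xm].
  have [|w01x dwx] := dw (k * (x - a)).
    by rewrite in_itv/= mulr_gt0 ?subr_gt0//= -kma ltr_pM2l// ltrD2r.
  split=> //; rewrite mulrC; apply: (@is_derive1_comp _ w (fun x => k * (x - a))).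
  by apply: is_derive_eq; rewrite /GRing.scale/=; ring.
have du2 (x : R) : x \in `]m, b[ ->
    0 < u2 x < 1 /\ is_derive x 1 u2 (- k * (1 - u2 x `^ s) `^ s^-1).
  rewrite in_itv/= => /andP[mx xb].
  have [|w01x dwx] := dw (k * (b - x)).
    by rewrite in_itv/= mulr_gt0 ?subr_gt0//= -kbm ltr_pM2l// ltrD2l ltrN2.
  split=> //; rewrite mulrC; apply: (@is_derive1_comp _ w (fun x => k * (b - x))).
  by apply: is_derive_eq; rewrite /GRing.scale/=; ring.
have u1a : u1 a = 0 by rewrite /u1 subrr mulr0.
have u2b : u2 b = 0 by rewrite /u2 subrr mulr0.
have u1m : u1 m = 1 by rewrite /u1 kma.
have u2m : u2 m = 1 by rewrite /u2 kbm.
(* This is the derivative of [u] on both open halves. It is defined everywhere and [|g|] is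
   continuous, even though the sign jumps at [m]. *)
pose g x := (if x <= m then k else - k) * sine_slope R s (u x).
have slope_ge0 y : 0 <= sine_slope R s y by exact: powR_ge0.
have cslope : continuous (fun x => sine_slope R s (u x)).
  by move=> x; apply: (@continuous_comp _ _ _ u); [exact: cu|exact: continuous_sine_slope].
have absg x : `|g x| = `|k * sine_slope R s (u x)|.
  by rewrite /g; case: ifP => // _; rewrite mulNr normrN.
have mg : measurable_fun `[a, b] g.
  apply: measurable_funM; last first.
    by apply: measurable_funTS; exact: continuous_measurable_fun.
  by apply: measurable_fun_if => //; exact: measurable_fun_ler.
have cg r : 0 < r -> continuous (fun x => `|k * sine_slope R s (u x)| `^ r).
  move=> r0 x.
  apply: (@continuous_comp _ _ _ (fun x => k * sine_slope R s (u x))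
    (fun t : R => `|t| `^ r)).
    by apply: cvgM; [exact: cvg_cst|exact: cslope].
  exact: continuous_norm_powR.
have intg : (@lebesgue_measure R).-integrable `[a, b] (EFin \o g).
  have : (@lebesgue_measure R).-integrable `[a, b]
      (EFin \o (fun x => k * sine_slope R s (u x))).
    apply: integrable_continuous_itv => x.
    by apply: cvgM; [exact: cvg_cst|exact: cslope].
  apply: le_integrable => //; first exact/measurable_EFinP.
  by move=> x _; rewrite /= lee_fin absg.
have g1E x : a <= x <= m -> \int[@lebesgue_measure R]_(t in `[a, x]) g t = u x.
  move=> /andP[ax xm]; rewrite u1E//.
  move: ax; rewrite le_eqVlt => /predU1P[<-|ax].
    by rewrite set_itv1 Rintegral_set1 u1a.
  have := @Rintegral_sine_slope R s k a x u1 s1 ax cu1; rewrite u1a subr0 => <-.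
    apply: eq_Rintegral => t; rewrite inE/= in_itv/= => /andP[_ tx].
    by rewrite /g (le_trans tx xm) u1E// (le_trans tx).
  move=> t; rewrite in_itv/= => /andP[t1 t2]; apply: du1.
  by rewrite in_itv/= t1 (lt_le_trans t2).
have g2E x : m <= x <= b -> \int[@lebesgue_measure R]_(t in `[a, x]) g t = u x.
  move=> /andP[mx xb]; rewrite (@Rintegral_itv_split _ _ _ m) ?(ltW am)//; last first.
    apply: integrableS intg => // t; rewrite /= !in_itv/= => /andP[-> tx].
    exact: le_trans xb.
  rewrite g1E ?lexx ?(ltW am)// u1E// u1m u2E//.
  move: mx; rewrite le_eqVlt => /predU1P[<-|mx].
    by rewrite set_itv1 Rintegral_set1 u2m addr0.
  have I2 : \int[@lebesgue_measure R]_(t in `[m, x]) (- k * sine_slope R s (u2 t)) =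
      u2 x - u2 m.
    apply: Rintegral_sine_slope => // t; rewrite in_itv/= => /andP[t1 t2]; apply: du2.
    by rewrite in_itv/= t1 (lt_le_trans t2).
  rewrite [RHS](_ : _ = 1 + (u2 x - u2 m)); last by rewrite u2m; ring.
  congr (_ + _); apply: etrans I2.
  have icont : continuous (fun t => - k * sine_slope R s (u2 t)).
    move=> t; apply: cvgM; first exact: cvg_cst.
    by apply: (@continuous_comp _ _ _ u2); [exact: cu2|exact: continuous_sine_slope].
  (* At [m] itself [g] carries the sign of the left half, so that point is removed from both
     integrals before the integrands are compared. *)
  rewrite -[LHS]Rintegral_itv_obnd_cbnd; last first.
    apply: integrableS intg => // t; rewrite /= !in_itv/= => /andP[mt tx].
    by rewrite (ltW (lt_trans am mt)) (le_trans tx).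
  rewrite -[RHS]Rintegral_itv_obnd_cbnd; last first.
    have := integrable_continuous_itv R m x _ icont; apply: integrableS => //.
    by move=> t; rewrite /= !in_itv/= => /andP[/ltW -> ->].
  apply: eq_Rintegral => t; rewrite inE/= in_itv/= => /andP[mt _].
  by rewrite /g leNgt mt/= u2E// ltW.
have us01 x : 0 <= `|u x| `^ s <= 1.
  rewrite powR_ge0/= -[leRHS](congr1 (@^~ s) (powR1 R)).
  have /andP[uge0 ule1] := w01 (k * Num.min (x - a) (b - x)).
  by rewrite ge0_ler_powR ?nnegrE ?(ltW s0)// ger0_norm.
have cus : continuous (fun x => `|u x| `^ s).
  move=> x; apply: (@continuous_comp _ _ _ u (fun y : R => `|y| `^ s)); first exact: cu.
  exact: continuous_norm_powR.
have ius c d : (@lebesgue_measure R).-integrable `[c, d] (EFin \o (fun x => `|u x| `^ s)).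
  exact: integrable_continuous_itv.
have icst (e c d : R) : (@lebesgue_measure R).-integrable `[c, d] (EFin \o (fun _ => e)).
  by apply: integrable_continuous_itv; exact: cst_continuous.
have Icst (e : R) : \int[@lebesgue_measure R]_(x in `[a, b]) e = e * (b - a).
  by rewrite Rintegral_cst//= lebesgue_measure_itv/= lte_fin ab.
have isus c d : (@lebesgue_measure R).-integrable `[c, d] (EFin \o (fun x => s * `|u x| `^ s)).
  apply: integrable_continuous_itv => x; apply: cvgM; first exact: cvg_cst.
  exact: cus.
(* On each half the primitive vanishes at both ends, as [u] is 0 at [a] and [b] and 1 at [m]. This
   determines the integral of [|u|^s] without evaluating it directly. *)
have I0 : \int[@lebesgue_measure R]_(x in `[a, b]) (1 - s * `|u x| `^ s) = 0.
  rewrite (@Rintegral_itv_split _ _ _ m) ?(ltW am) ?(ltW mb)//; last first.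
    apply: integrable_continuous_itv => x; apply: cvgB; first exact: cvg_cst.
    by apply: cvgM; [exact: cvg_cst|exact: cus].
  have e11 : 1 `^ s = 1 :> R by rewrite powR1.
  have := @Rintegral_sine_powR R s k a m u1 s1 _ am cu1 du1.
  rewrite u1a u1m mul0r normr1 e11 subrr mulr0 gt_eqF// => /(_ isT erefl erefl) I1.
  have := @Rintegral_sine_powR R s (- k) m b u2 s1 _ mb cu2 du2.
  rewrite u2b u2m mul0r normr1 e11 subrr mulr0 oppr_eq0 gt_eqF// => /(_ isT erefl erefl) I2.
  transitivity (0 + 0 : R); last by rewrite addr0.
  congr (_ + _); [apply: etrans I1 | apply: etrans I2]; apply: eq_Rintegral => x;
    rewrite inE/= in_itv/= => /andP[x1 x2]; first by rewrite u1E.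
  by rewrite u2E.
have Ius : \int[@lebesgue_measure R]_(x in `[a, b]) (`|u x| `^ s) = (b - a) / s.
  move: I0; rewrite RintegralB// Icst mul1r RintegralZl// => /subr0_eq ->.
  by field; rewrite gt_eqF.
exists u, g; split=> //.
- move=> r r0; split=> //; split; last split.
  + under eq_integral do rewrite absg.
    have /integrableP[_] := integrable_continuous_itv _ a b _ (cg _ r0).
    apply: le_lt_trans; rewrite le_eqVlt; apply/orP; left.
    apply/eqP/eq_integral => x _.
    by rewrite /= (ger0_norm (powR_ge0 _ _)).
  + move=> x /andP[ax xb]; have [xm|mx] := leP x m.
      by rewrite g1E// ax.
    by rewrite g2E// (ltW mx).
  + by rewrite u2E// ltW.
- by rewrite u1E.
(* The equation of the s-sine gives [|g|^s = k^s (1 - |u|^s)], because [|u| <= 1]. *)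
- transitivity (\int[@lebesgue_measure R]_(x in `[a, b]) (k `^ s * (1 - `|u x| `^ s))).
    apply: eq_Rintegral => x _; rewrite absg normrM (gtr0_norm k0) ger0_norm//.
    rewrite powRM ?(ltW k0)// /sine_slope -powRrM mulVf ?gt_eqF// powRr1//.
    by rewrite ger0_norm// subr_ge0; have /andP[] := us01 x.
  rewrite RintegralZl//; last first.
    apply: integrable_continuous_itv => x; apply: cvgB; first exact: cvg_cst.
    exact: cus.
  by rewrite RintegralB// Icst Ius; field; rewrite gt_eqF.
Qed.

(** * Bounds for functions in the Sobolev space *)

(* Young's inequality at scale [t], the mean of [f], yields Jensen's inequality. *)
Lemma Rintegral_jensen_powR (R : realType) (a b p : R) (f : R -> R) :
  1 < p -> a < b -> (forall x, 0 <= f x) ->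
  (@lebesgue_measure R).-integrable `[a, b] (EFin \o f) ->
  (@lebesgue_measure R).-integrable `[a, b] (EFin \o (fun x => f x `^ p)) ->
  (\int[@lebesgue_measure R]_(x in `[a, b]) f x) `^ p <=
  (b - a) `^ (p - 1) * \int[@lebesgue_measure R]_(x in `[a, b]) (f x `^ p).
Proof.
move=> p1 ab f0 fi fpi; have p0 : 0 < p by exact: lt_trans p1.
have L0 : 0 < b - a by rewrite subr_gt0.
set B := (X in X `^ p <= _); set A := (X in _ <= _ * X).
have A0 : 0 <= A by apply: Rintegral_ge0 => x _; exact: powR_ge0.
have : 0 <= B by apply: Rintegral_ge0.
rewrite le_eqVlt => /predU1P[<-|B0]; first by rewrite powR0 ?gt_eqF// mulr_ge0// powR_ge0.
pose t := B / (b - a); have t0 : 0 < t by rewrite divr_gt0.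
(* Young's inequality for [f x / t] and 1, multiplied by [t], has exactly these coefficients. *)
pose c := t / t `^ p / p; pose e := t * (1 - p^-1).
have young x : f x <= c * f x `^ p + e.
  have q0 : 0 < 1 - p^-1 by rewrite subr_gt0 invf_lt1.
  have q'0 : 0 < (1 - p^-1)^-1 by rewrite invr_gt0.
  have pq : p^-1 + (1 - p^-1)^-1^-1 = 1 by rewrite invrK addrC subrK.
  have := conjugate_powR (divr_ge0 (f0 x) (ltW t0)) ler01 p0 q'0 pq.
  rewrite invrK powR1 mulr1 mul1r.
  rewrite powRM ?invr_ge0 ?(ltW t0)//.
  rewrite -(ler_pM2l t0) mulrCA divff ?gt_eqF// mulr1 mulrDr => /le_trans; apply.
  rewrite lerD2r /c -(powR_inv1 (ltW t0)) -powRrM mulN1r powRN.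
  by rewrite le_eqVlt; apply/orP; left; apply/eqP; ring.
have ecst (r : R) : (@lebesgue_measure R).-integrable `[a, b] (EFin \o (fun _ => r)).
  by apply: integrable_continuous_itv; exact: cst_continuous.
have cfi : (@lebesgue_measure R).-integrable `[a, b] (EFin \o (fun x => c * f x `^ p)).
  by have := integrableZl _ c fpi; apply.
have : B <= c * A + e * (b - a).
  apply: (@le_trans _ _ (\int[@lebesgue_measure R]_(x in `[a, b]) (c * f x `^ p + e))).
    apply: le_Rintegral => //.
    by have := integrableD _ cfi (ecst e); apply.
  rewrite RintegralD// RintegralZl// Rintegral_cst//= lebesgue_measure_itv/= lte_fin ab.
  by rewrite lexx.
have tL : t * (b - a) = B by rewrite /t divfK ?gt_eqF.
(* With [t] the mean, the constant term integrates to the share [1 - 1/p] of [B]. Subtracting it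
   leaves [B / p <= c A]. *)
have -> : e * (b - a) = B * (1 - p^-1) by rewrite -tL /e; ring.
move=> H.
have {}H : B <= t / t `^ p * A.
  have : B / p <= t / t `^ p * A / p.
    have -> : t / t `^ p * A / p = c * A by rewrite /c [RHS]mulrAC.
    by move: H; rewrite mulrBr mulr1; lra.
  by rewrite ler_pM2r ?invr_gt0.
move: H; have tp0 : 0 < t `^ p by rewrite powR_gt0.
have -> : B `^ p = t `^ p * (b - a) `^ p by rewrite -tL powRM ?(ltW t0) ?(ltW L0).
rewrite -{1}tL -mulrA ler_pM2l// ler_pdivlMl// => Ht.
rewrite -(mulr_powRB1 (ltW L0) p0).
have -> : t `^ p * ((b - a) * (b - a) `^ (p - 1)) =
  (b - a) `^ (p - 1) * (t `^ p * (b - a)) by ring.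
by rewrite ler_wpM2l// powR_ge0.
Qed.

(** Integrability of [g] follows from [|g| <= |g|^p + 1] on an interval of finite length. *)
Lemma W10_integrable (R : realType) (a b p : R) (u g : R -> R) : 1 < p -> W10 a b p u g ->
  (@lebesgue_measure R).-integrable `[a, b] (EFin \o g) /\
  (@lebesgue_measure R).-integrable `[a, b] (EFin \o (fun x => `|g x| `^ p)).
Proof.
move=> p1 [mg [gp _]].
have mgp : measurable_fun `[a, b] (fun x => `|g x| `^ p).
  apply: (@measurableT_comp _ _ _ _ _ _ (fun t : R => t `^ p)) => //.
  exact: measurableT_comp.
have gpi : (@lebesgue_measure R).-integrable `[a, b] (EFin \o (fun x => `|g x| `^ p)).
  apply/integrableP; split; first exact/measurable_EFinP.
  by under eq_integral do rewrite /= (ger0_norm (powR_ge0 _ _)).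
split=> //.
have i1 : (@lebesgue_measure R).-integrable `[a, b] (EFin \o (fun _ => 1)).
  by apply: integrable_continuous_itv; exact: cst_continuous.
have := integrableD _ gpi i1 => /(_ (measurable_itv _)); apply: le_integrable => //.
  exact/measurable_EFinP.
move=> x _; rewrite /= lee_fin (@ger0_norm _ (_ + _)) ?addr_ge0 ?powR_ge0//.
have [g1|g1] := leP `|g x| 1; first by rewrite (le_trans g1)// lerDr powR_ge0.
by rewrite ler_wpDr// le1r_powR// ltW.
Qed.

(* [u] vanishes at both ends, so [|u x|] is bounded by the integral of [|g|] on
   either side of [x], hence by half the total. *)
Lemma W10_sup_bound (R : realType) (a b p : R) (u g : R -> R) (x : R) : 1 < p -> a < b ->
  W10 a b p u g -> a <= x <= b ->
  (2 * `|u x|) `^ p <=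
  (b - a) `^ (p - 1) * \int[@lebesgue_measure R]_(x in `[a, b]) (`|g x| `^ p).
Proof.
move=> p1 ab W /andP[ax xb]; have p0 : 0 < p by exact: lt_trans p1.
have [gi gpi] := @W10_integrable R a b p u g p1 W.
have agi : (@lebesgue_measure R).-integrable `[a, b] (EFin \o (fun x => `|g x|)).
  exact: (integrable_norm gi).
apply: le_trans (@Rintegral_jensen_powR R a b p (fun x => `|g x|) p1 ab _ agi gpi) => //.
rewrite ge0_ler_powR ?nnegrE ?(ltW p0) ?mulr_ge0 ?Rintegral_ge0//.
case: W => mg [_ [uE ub]].
have gax : (@lebesgue_measure R).-integrable `[a, x] (EFin \o g).
  apply: integrableS gi => // y; rewrite /= !in_itv/= => /andP[-> yx].
  exact: le_trans xb.
have gxb : (@lebesgue_measure R).-integrable `[x, b] (EFin \o g).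
  apply: integrableS gi => // y; rewrite /= !in_itv/= => /andP[xy ->].
  by rewrite (le_trans ax).
rewrite (@Rintegral_itv_split R _ a x b) ?ax//.
have ux : `|u x| <= \int[@lebesgue_measure R]_(y in `[a, x]) `|g y|.
  by rewrite uE ?ax//; exact: le_normr_Rintegral.
have u'x : `|u x| <= \int[@lebesgue_measure R]_(y in `[x, b]) `|g y|.
  have := uE b; rewrite ub lexx (ltW ab) => /(_ isT).
  rewrite (@Rintegral_itv_split R _ a x b) ?ax// -uE ?ax// => /esym/eqP.
  rewrite addr_eq0 => /eqP ->; rewrite normrN; exact: le_normr_Rintegral.
by rewrite mulr_natl mulr2n lerD.
Qed.

(** On the interval [u] agrees with an indefinite integral, which is continuous. *)
Lemma W10_measurable (R : realType) (a b p : R) (u g : R -> R) : 1 < p -> a < b ->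
  W10 a b p u g -> measurable_fun `[a, b] u.
Proof.
move=> p1 ab W; have [gi _] := @W10_integrable R a b p u g p1 W.
case: W => _ [_ [uE _]].
apply: (@eq_measurable_fun _ _ _ _ _
  (fun x => \int[@lebesgue_measure R]_(t in `[a, x]) g t)).
  by move=> x; rewrite inE/= in_itv/= => /uE ->.
apply: subspace_continuous_measurable_fun => //.
exact: (parameterized_integral_continuous (ltW ab)).
Qed.

(** * Lower bound for the energy of the system *)

(** This is Young's inequality with conjugate exponents [p / alpha] and [q / beta], applied to
    powers of [A / alpha] and [B / beta]. The rescaling turns the weights into [1/p] and [1/q] and
    produces the constant. *)
Lemma weighted_AGM (R : realType) (p q alpha beta A B : R) :
  0 < p -> 0 < q -> 0 < alpha -> 0 < beta -> alpha / p + beta / q = 1 ->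
  0 <= A -> 0 <= B ->
  A `^ (alpha / p) * B `^ (beta / q) <=
  alpha `^ (alpha / p) * beta `^ (beta / q) * (p^-1 * A + q^-1 * B).
Proof.
move=> p0 q0 al0 be0 pq A0 B0.
have scale (x y e : R) : 0 < y -> 0 <= x -> x `^ e = y `^ e * (x / y) `^ e.
  move=> y0 x0; rewrite -powRM ?(ltW y0) ?divr_ge0 ?(ltW y0)//.
  by rewrite mulrCA divff ?mulr1// gt_eqF.
rewrite (scale A alpha)// (scale B beta)// mulrACA ler_wpM2l//.
  by rewrite mulr_ge0// powR_ge0.
have := @conjugate_powR R ((A / alpha) `^ (alpha / p)) ((B / beta) `^ (beta / q))
  (alpha / p)^-1 (beta / q)^-1 (powR_ge0 _ _) (powR_ge0 _ _).
rewrite !invrK -!powRrM !mulfV ?gt_eqF ?divr_gt0// => /(_ _ _ pq).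
rewrite !invr_gt0 !divr_gt0// => /(_ isT isT).
rewrite !powRr1 ?divr_ge0 ?(ltW al0) ?(ltW be0)//.
have -> : A / alpha * (alpha / p) = p^-1 * A by field; rewrite !gt_eqF.
by have -> : B / beta * (beta / q) = q^-1 * B by field; rewrite !gt_eqF.
Qed.

Lemma W10_Rintegral_powRM (R : realType) (p q alpha beta a b : R) (u g v h : R -> R) :
  1 < p -> 1 < q -> 0 < alpha -> 0 < beta -> alpha / p + beta / q = 1 -> a < b ->
  W10 a b p u g -> W10 a b q v h ->
  \int[@lebesgue_measure R]_(x in `[a, b]) (`|u x| `^ alpha * `|v x| `^ beta) <=
  ((b - a) / 2) `^ (alpha + beta) *
  ((\int[@lebesgue_measure R]_(x in `[a, b]) (`|g x| `^ p)) `^ (alpha / p) *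
   (\int[@lebesgue_measure R]_(x in `[a, b]) (`|h x| `^ q)) `^ (beta / q)).
Proof.
move=> p1 q1 al0 be0 pq ab Wu Wv.
have p0 : 0 < p by exact: lt_trans p1.
have q0 : 0 < q by exact: lt_trans q1.
set A := (X in _ * (X `^ _ * _)); set B := (X in _ * (_ * X `^ _)).
have A0 : 0 <= A by apply: Rintegral_ge0 => x _; exact: powR_ge0.
have B0 : 0 <= B by apply: Rintegral_ge0 => x _; exact: powR_ge0.
have L0 : 0 < b - a by rewrite subr_gt0.
pose L := b - a.
pose M := L `^ (alpha + beta - 1) * (A `^ (alpha / p) * B `^ (beta / q)) /
  2 `^ (alpha + beta).
(* The supremum bound is raised to the power [e / r]; it is used with [(e, r)] equal to [(alpha, p)]
   and [(beta, q)]. *)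
have bnd (e r S y : R) : 0 < e -> 0 < r -> 0 <= S -> 0 <= y ->
    (2 * y) `^ r <= L `^ (r - 1) * S ->
    2 `^ e * y `^ e <= L `^ (e - e / r) * S `^ (e / r).
  move=> e0 r0 S0 y0 H.
  have er : e = r * (e / r) by rewrite mulrCA divff ?mulr1// gt_eqF.
  rewrite -powRM// {1}er powRrM.
  have -> : L `^ (e - e / r) = (L `^ (r - 1)) `^ (e / r).
    by rewrite -powRrM mulrBl mul1r -er.
  rewrite -powRM ?powR_ge0// ge0_ler_powR ?nnegrE ?powR_ge0 ?(mulr_ge0 _ y0)//.
  - by rewrite divr_ge0 ?ltW.
  - by rewrite mulr_ge0 ?powR_ge0.
have ptw x : x \in `[a, b] -> `|u x| `^ alpha * `|v x| `^ beta <= M.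
  rewrite in_itv/= => xab.
  have Hu := bnd _ _ _ _ al0 p0 A0 (normr_ge0 (u x))
    (@W10_sup_bound R a b p u g x p1 ab Wu xab).
  have Hv := bnd _ _ _ _ be0 q0 B0 (normr_ge0 (v x))
    (@W10_sup_bound R a b q v h x q1 ab Wv xab).
  rewrite /M ler_pdivlMr ?powR_gt0//.
  (* The exponents of [L] add up because [alpha / p + beta / q = 1]. *)
  have -> : L `^ (alpha + beta - 1) = L `^ (alpha - alpha / p) * L `^ (beta - beta / q).
    rewrite -powRD ?(gt_eqF L0) ?implybT//; congr (_ `^ _).
    by rewrite -pq; ring.
  rewrite [2 `^ _]powRD ?pnatr_eq0 ?implybT// mulrACA [leRHS]mulrACA.
  rewrite !(mulrC (`|_| `^ _) (2 `^ _)).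
  by apply: ler_pM Hu Hv; rewrite mulr_ge0 ?powR_ge0.
have M0 : 0 <= M by rewrite /M divr_ge0 ?mulr_ge0 ?powR_ge0.
have icst : (@lebesgue_measure R).-integrable `[a, b] (EFin \o (fun _ => M)).
  by apply: integrable_continuous_itv; exact: cst_continuous.
have muv : measurable_fun `[a, b] (fun x => `|u x| `^ alpha * `|v x| `^ beta).
  have mpow (e : R) (w : R -> R) : measurable_fun `[a, b] w ->
      measurable_fun `[a, b] (fun x => `|w x| `^ e).
    move=> mw; apply: (@measurableT_comp _ _ _ _ _ _ (fun t : R => t `^ e)) => //.
    exact: measurableT_comp.
  apply: measurable_funM; apply: mpow.
    exact: (@W10_measurable R a b p u g).
  exact: (@W10_measurable R a b q v h).
have iuv : (@lebesgue_measure R).-integrable `[a, b]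
    (EFin \o (fun x => `|u x| `^ alpha * `|v x| `^ beta)).
  move: icst; apply: le_integrable => //; first exact/measurable_EFinP.
  move=> x xab; rewrite /= lee_fin (ger0_norm M0).
  rewrite (ger0_norm (mulr_ge0 (powR_ge0 _ _) (powR_ge0 _ _))).
  by apply: ptw; exact: xab.
apply: (@le_trans _ _ (\int[@lebesgue_measure R]_(x in `[a, b]) M)).
  by apply: le_Rintegral => // x xab; apply: ptw; exact: xab.
rewrite Rintegral_cst//= lebesgue_measure_itv/= lte_fin ab/= -/L.
rewrite le_eqVlt; apply/orP; left; apply/eqP.
(* Integrating the constant [M] contributes one more factor [L], raising its exponent to
   [alpha + beta]. *)
rewrite powRM ?invr_ge0 ?(ltW L0)// /M -(mulr_powRB1 (ltW L0) (addr_gt0 al0 be0)) -/L.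
have -> : 2^-1 `^ (alpha + beta) = (2 `^ (alpha + beta))^-1 :> R.
  by rewrite -(powR_inv1 (ler0n R 2)) -powRrM mulN1r powRN.
move: (L `^ _) (_ * B `^ _) ((2 `^ _)^-1) => W X T.
by ring.
Qed.

(** * Comparison of the eigenvalues *)

Lemma Lambda1_le (R : realType) (a b s : R) : 1 < s -> 0 < pi_s s -> a < b ->
  Lambda1 a b s <= (s - 1) * (pi_s s / (b - a)) `^ s.
Proof.
move=> s1 pi0 ab; have s0 : 0 < s by exact: lt_trans s1.
have [u [g [W um Iu Ig]]] := sine_test_function R s a b s1 pi0 ab.
apply: ge_inf.
  exists 0 => _ [v [h [_ _ ->]]].
  by rewrite divr_ge0// Rintegral_ge0// => x _; exact: powR_ge0.
exists u, g; split; first exact: W.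
  by exists ((a + b) / 2); [lra|rewrite um oner_neq0].
by rewrite Iu Ig; field; rewrite subr_eq0 !gt_eqF.
Qed.

Theorem theorem1p2 (R : realType) (p q alpha beta a b : R) :
  1 < p -> 1 < q -> 0 < alpha -> 0 < beta ->
  alpha / p + beta / q = 1 -> a < b ->
  (alpha `^ (alpha / p) * beta `^ (beta / q))^-1
    * (2 / pi_s (alpha + beta)) `^ (alpha + beta)
    * (Lambda1 a b (alpha + beta) / (alpha + beta - 1))
  <= lambda1 a b p q alpha beta.
Proof.
move=> p1 q1 al0 be0 pq ab; set s := alpha + beta.
have p0 : 0 < p by exact: lt_trans p1.
have q0 : 0 < q by exact: lt_trans q1.
have L0 : 0 < b - a by rewrite subr_gt0.
(* Since [p] and [q] exceed 1, [1 = alpha / p + beta / q < alpha + beta]. *)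
have s1 : 1 < s.
  by rewrite /s -pq ltrD// ltr_pdivrMr// ltr_pMr.
have s0 : 0 < s by exact: lt_trans s1.
set C := alpha `^ _ * _; have C0 : 0 < C by rewrite mulr_gt0// powR_gt0.
have [pi0|pi0] := leP (pi_s s) 0.
  (* junk value: [pi_s s = 0] would mean a divergent integral, and [2 / 0 = 0] *)
  have -> : pi_s s = 0.
    apply/eqP; rewrite eq_le pi0 /pi_s mulr_ge0// fine_ge0// integral_ge0// => x _.
    by rewrite lee_fin powR_ge0.
  rewrite invr0 mulr0 powR0 ?gt_eqF// mulr0 mul0r.
  (* The left side is now 0. Every quotient is nonnegative, and the infimum of the empty set is 0 by
     convention, so the bound holds in either case. *)
  rewrite /lambda1; set E := mkset _; have [E0|E0] := pselect (E !=set0).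
    apply: lb_le_inf => // _ [u [g [v [h [_ _ I0 ->]]]]].
    by rewrite divr_ge0 ?(ltW I0)// addr_ge0// mulr_ge0 ?invr_ge0 ?(ltW p0) ?(ltW q0)//;
      apply: Rintegral_ge0 => x _; exact: powR_ge0.
  by rewrite (_ : E = set0) ?inf0//; apply/eqP/negPn/negP => /set0P.
apply: (@le_trans _ _ (C^-1 * (2 / (b - a)) `^ s)).
  rewrite -mulrA ler_wpM2l ?invr_ge0 ?(ltW C0)//.
  (* Inserting [pi_s s] separates the factor of the statement from the one in the bound on
     [Lambda1]. *)
  have -> : 2 / (b - a) = 2 / pi_s s * (pi_s s / (b - a)).
    by rewrite mulrA divfK// gt_eqF.
  rewrite [leRHS]powRM ?divr_ge0 ?(ltW pi0) ?(ltW L0)// ler_wpM2l ?powR_ge0//.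
  by rewrite ler_pdivrMr ?subr_gt0// mulrC; exact: Lambda1_le.
apply: lb_le_inf.
  (* A lower bound passes to the infimum only for a nonempty set. The pair [(u, u)] is admissible,
     its coupled integral being that of [|u|^s]. *)
  have [u [g [W _ Iu _]]] := sine_test_function R s a b s1 pi0 ab.
  have Iuu : \int[@lebesgue_measure R]_(x in `[a, b]) (`|u x| `^ alpha * `|u x| `^ beta)
      = (b - a) / s.
    rewrite -Iu; apply: eq_Rintegral => x _.
    by rewrite -powRD// (gt_eqF s0).
  eexists; exists u, g, u, g; split; [exact: W|exact: W| |reflexivity].
  by rewrite Iuu divr_gt0.
move=> _ [u [g [v [h [Wu Wv I0 ->]]]]]; rewrite ler_pdivlMr//.
have := @W10_Rintegral_powRM R p q alpha beta a b u g v h p1 q1 al0 be0 pq ab Wu Wv.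
set I := Rintegral _ _ _ in I0 *; rewrite -/s.
set A := (X in _ * (X `^ _ * _)); set B := (X in _ * (_ * X `^ _)) => H.
have A0 : 0 <= A by apply: Rintegral_ge0 => x _; exact: powR_ge0.
have B0 : 0 <= B by apply: Rintegral_ge0 => x _; exact: powR_ge0.
have AB := @weighted_AGM R p q alpha beta A B p0 q0 al0 be0 pq A0 B0.
rewrite -mulrA mulrC ler_pdivrMr// [leRHS]mulrC; apply: le_trans AB.
(* The factors [(2 / L)^s] and [(L / 2)^s] cancel, leaving the left side of the weighted
   inequality. *)
apply: (le_trans (ler_wpM2l (powR_ge0 _ _) H)).
rewrite [leLHS]mulrA.
have -> : (2 / (b - a)) `^ s * ((b - a) / 2) `^ s = 1.
  rewrite -powRM ?divr_ge0 ?(ltW L0)// mulrA divfK ?gt_eqF// divff//.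
  by rewrite powR1.
by rewrite mul1r.
Qed.
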